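(* Let $\mathrm{Sol}_{NC}$ denote the set of stable noncommutative polynomials $P=(P_n)_{n\ge0}\in\mathbb{C}\langle A\rangle$ such that for every $n\ge 2$ and every $1\le i<n$, \[ P_n(a_1,\dots,a_n)\big|_{a_{i+1}=a_i}=P_{n-2}(a_1,\dots,a_{i-1},a_{i+2},\dots,a_n). \] Then, as an algebra, $\mathrm{Sol}_{NC}$ is isomorphic to the algebra $\mathbf{WQSym}$ of word quasi-symmetric functions.
   Context: $A=\{a_1,a_2,\dots\}$ are noncommuting variables. A stable noncommutative polynomial is a sequence $P=(P_n)_{n\ge0}$ with $P_n\in\mathbb{C}\langle a_1,\dots,a_n\rangle$ (polynomials in $n$ noncommuting variables), of bounded degree, with $P_{n+1}(a_1,\dots,a_n,0)=P_n(a_1,\dots,a_n)$; these form the algebra $\mathbb{C}\langle A\rangle$. For a word $w=w_1\cdots w_k$ over the positive integers write $\mathbf{a}_w=a_{w_1}\cdots a_{w_k}$. A word $u$ is packed if whenever a letter $j+1$ occurs in $u$, the letter $j$ also occurs. The packing $\mathrm{pack}(w)$ of a word $w$ is obtained by replacing all occurrences of the smallest letter of $w$ by $1$, of the second smallest by $2$, etc. For a packed word $u$, $P_u=\sum_{w:\ \mathrm{pack}(w)=u}\mathbf{a}_w\in\mathbb{C}\langle A\rangle$, and $\mathbf{WQSym}$ is the subalgebra of $\mathbb{C}\langle A\rangle$ spanned by the $P_u$. *)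

(* Defs.v *)
From HB Require Import structures.
From mathcomp Require Import all_boot all_order all_algebra.
From mathcomp Require Import finmap.
From mathcomp Require Import boolp functions reals.
From mathcomp Require Import complex.
From mathcomp.multinomials Require Import monalg.

Set Implicit Arguments.
Unset Strict Implicit.
Unset Printing Implicit Defensive.

Import GRing.Theory.
Local Open Scope ring_scope.

Section Packing.
Implicit Types (u w : seq nat).

Definition packed u :=
  {in u, forall j, 0 < j}%N /\
  forall j, (0 < j)%N -> j.+1 \in u -> j \in u.

Definition letters w := sort leq (undup w).

Definition pack w := [seq (index x (letters w)).+1 | x <- w].

Lemma mem_letters w : letters w =i w.
Proof. by move=> x; rewrite mem_sort mem_undup. Qed.

Lemma letters_uniq w : uniq (letters w).
Proof. by rewrite sort_uniq undup_uniq. Qed.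

Lemma size_pack w : size (pack w) = size w.
Proof. exact: size_map. Qed.

Lemma pack_packed w : packed (pack w).
Proof.
split=> [j /mapP[x _ ->] // | j j_gt0 /mapP[x xw [jE]]].
have ltj : (j < size (letters w))%N by rewrite jE index_mem mem_letters.
have ltj' : (j.-1 < size (letters w))%N by apply: leq_ltn_trans (leq_pred j) ltj.
apply/mapP; exists (nth 0%N (letters w) j.-1).
  by rewrite -mem_letters mem_nth.
by rewrite index_uniq ?letters_uniq // prednK.
Qed.

Lemma pack_le_size w : all (fun i => 0 < i <= size w)%N (pack w).
Proof.
apply/allP=> j /mapP[x xw ->] /=.
have /leq_trans : (index x (letters w) < size (letters w))%N.
  by rewrite index_mem mem_letters.
by apply; rewrite size_sort size_undup.
Qed.

Lemma index_map_in (T T' : eqType) (f : T -> T') (s : seq T) x :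
  {in s &, injective f} -> x \in s -> index (f x) (map f s) = index x s.
Proof.
elim: s => //= y s IHs finj; rewrite inE.
have [->|nyx] /= := eqVneq x y; first by rewrite !eqxx.
move=> xs.
have /negPf -> : f y != f x.
  by apply: contraNneq nyx => /finj ->; rewrite // inE ?eqxx ?xs ?orbT.
by rewrite IHs // => a b as_ bs; apply: finj; rewrite inE ?as_ ?bs orbT.
Qed.

Lemma pack_map f w :
  {in w &, {mono f : x y / (x <= y)%N}} -> pack (map f w) = pack w.
Proof.
move=> fmono.
have finj : {in w &, injective f}.
  by move=> x y xw yw fxy; apply/eqP; rewrite eqn_leq -(fmono x y) // -(fmono y x) // fxy leqnn.
have lettersE : letters (map f w) = map f (letters w).
  apply: (sorted_eq leq_trans anti_leq).
  - by apply: sort_sorted; exact: leq_total.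
  - rewrite sorted_map.
    have lw : {in letters w &, relpre f leq =2 leq}.
      by move=> x y; rewrite !mem_letters => xw yw /=; rewrite fmono.
    rewrite (eq_in_sorted lw); last by apply/allP.
    by apply: sort_sorted; exact: leq_total.
  - apply: uniq_perm; rewrite ?letters_uniq //.
      rewrite map_inj_in_uniq ?letters_uniq // => x y.
      by rewrite !mem_letters; apply: finj.
    move=> x; rewrite mem_letters.
    apply/mapP/mapP => -[y yw ->]; exists y => //; move: yw;
      by rewrite mem_letters.
rewrite /pack -map_comp; apply/eq_in_map => x xw /=.
rewrite lettersE index_map_in ?mem_letters // => a b.
by rewrite !mem_letters; apply: finj.
Qed.

Lemma rank_mono w :
  {in w &, {mono (fun x => (index x (letters w)).+1) : x y / (x <= y)%N}}.
Proof.
have lt_rank x y : x \in w -> y \in w -> (x < y)%N ->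
    (index x (letters w) < index y (letters w))%N.
  move=> xw yw xy; rewrite ltnNge; apply/negP => le_yx.
  suff h : (y <= x)%N by rewrite ltnNge h in xy.
  rewrite -[y](nth_index 0%N (s := letters w)) ?mem_letters //.
  rewrite -[X in (_ <= X)%N](nth_index 0%N (s := letters w)) ?mem_letters //.
  apply: (sorted_leq_nth leq_trans leqnn) => //.
  - by apply: sort_sorted; exact: leq_total.
  - by rewrite inE index_mem mem_letters.
  - by rewrite inE index_mem mem_letters.
move=> x y xw yw; rewrite ltnS.
case: (leqP x y) => [|/(lt_rank _ _ yw xw) h]; last by rewrite leqNgt h.
by rewrite leq_eqVlt => /orP[/eqP->|/(lt_rank _ _ xw yw)/ltnW ->]; rewrite ?leqnn.
Qed.

Lemma pack_take k w : pack (take k (pack w)) = pack (take k w).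
Proof.
rewrite -map_take pack_map // => x y xw yw.
by rewrite rank_mono // (mem_take (n0 := k)).
Qed.

Lemma pack_drop k w : pack (drop k (pack w)) = pack (drop k w).
Proof.
rewrite -map_drop pack_map // => x y xw yw.
by rewrite rank_mono // (mem_drop (n0 := k)).
Qed.

Lemma packK w : pack (pack w) = pack w.
Proof. by rewrite -[in LHS](take_size (pack w)) pack_take size_pack take_size. Qed.

End Packing.

(* Letters and variables are numbered from 1: the letter 0 and the variable a_0
   exist in the type but never occur in a packed word or a stable polynomial.
   The algebra of polynomials in a_1, ..., a_n is represented by the elements
   of [ncpoly K] satisfying [inNC n], so that polynomials in different numbers
   of variables live in one type. *)
Notation ncpoly K := {malg K[{fmonom nat}]}.

Section NCPoly.
Variable K : comNzRingType.
Implicit Types (p q : ncpoly K) (w : {fmonom nat}) (n : nat).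

Definition ncword (w : seq nat) : ncpoly K := << FMonom w >>.

Definition ncvar (i : nat) : ncpoly K := ncword [:: i].

Definition word_in n (w : seq nat) := all (fun i => 0 < i <= n)%N w.

Definition inNC n p := {in msupp p, forall w, word_in n w}.

Definition prodw (s : nat -> ncpoly K) (w : {fmonom nat}) : ncpoly K :=
  \prod_(i <- w) s i.

(* Simultaneous substitution of s i for a_i, for all i. *)
Definition subst (s : nat -> ncpoly K) p : ncpoly K :=
  mmap (@malgC {fmonom nat} K) (prodw s) p.

Lemma FMonomM (u v : seq nat) : FMonom (u ++ v) = mmul (FMonom u) (FMonom v).
Proof. by apply/eqP; rewrite fmP fmM. Qed.

Lemma malgC_comm (c : K) p : GRing.comm (malgC c) p.
Proof.
rewrite /GRing.comm mul_malgC; apply/malgP=> w.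
rewrite malgM_def fgmulgU mcoeffZ [in LHS](monalgE p).
rewrite !raddf_sum mulr_sumr /=; apply: eq_bigr => k _.
by rewrite mulm1 !mcoeffU mulrnAr mulrC.
Qed.

Lemma ncpoly_scaleAr (c : K) p q : c *: (p * q) = p * (c *: q).
Proof. by rewrite -!mul_malgC mulrA malgC_comm mulrA. Qed.

Section Subst.
Variable s : nat -> ncpoly K.

Fact prodw_is_multiplicative : mmorphism (prodw s).
Proof.
split=> [w1 w2|]; rewrite /prodw; first by rewrite fmM big_cat.
by rewrite fm1 big_nil.
Qed.

HB.instance Definition _ :=
  isMultiplicative.Build {fmonom nat} (ncpoly K) (prodw s)
    prodw_is_multiplicative.

Fact subst_is_zmod_morphism : zmod_morphism (subst s).
Proof. exact: mmap_is_additive. Qed.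

HB.instance Definition _ :=
  GRing.isZmodMorphism.Build (ncpoly K) (ncpoly K) (subst s)
    subst_is_zmod_morphism.

Fact subst_is_monoid_morphism : monoid_morphism (subst s).
Proof.
have cf (g : ncpoly K) m m' := malgC_comm g@_m (prodw s m').
have [sM s1] := commr_mmap_is_multiplicative cf.
by split.
Qed.

HB.instance Definition _ :=
  GRing.isMonoidMorphism.Build (ncpoly K) (ncpoly K) (subst s)
    subst_is_monoid_morphism.

Fact subst_is_scalable : scalable (subst s).
Proof. by move=> c p; rewrite /subst mmapZ mul_malgC. Qed.

HB.instance Definition _ :=
  GRing.isScalable.Build K (ncpoly K) (ncpoly K) *:%R (subst s)
    subst_is_scalable.

End Subst.

Lemma prodw_ncvar w : prodw ncvar w = << w >>.
Proof.
case: w => w; rewrite /prodw /=; elim: w => [|i w IHw].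
  by rewrite big_nil /GRing.one /= /fgone; congr mkmalgU; apply/eqP; rewrite fmP fm1.
rewrite big_cons IHw malgM_def /ncvar /ncword fgmulUU mulr1.
by rewrite -FMonomM.
Qed.

Lemma mcoeff_subst0 k p (w : {fmonom nat}) :
  (subst (fun j => if j == k then 0 else ncvar j) p)@_w
    = if k \in (w : seq nat) then 0 else p@_w.
Proof.
pose s j := if j == k then 0 else ncvar j.
have sE v : prodw s v = if k \in (v : seq nat) then 0 else << v >>.
  case: ifPn => [kv|nkv].
    rewrite /prodw; case/splitPr: (v : seq nat) / kv => v1 v2.
    by rewrite big_cat big_cons /= /s eqxx mul0r mulr0.
  rewrite -prodw_ncvar /prodw; apply: eq_big_seq => i iv.
  by rewrite /s; case: eqP => // ik; rewrite -ik iv in nkv.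
rewrite /subst mmapE raddf_sum /=.
rewrite (eq_bigr (fun v => (if k \in (w : seq nat) then 0 else p@_v) *+ (v == w))).
  case: ifP => kw; first by rewrite big1 // => ? _; rewrite mul0rn.
  rewrite [in RHS](monalgE p) raddf_sum /=.
  by apply: eq_bigr => v _; rewrite mcoeffU.
move=> v _; rewrite mul_malgC mcoeffZ sE.
case: eqVneq => [->|nvw]; first by case: ifP; rewrite ?mcoeff0 ?mcoeffUU ?mulr0 ?mulr1.
by rewrite (fun_if (mcoeff w)) mcoeff0 mcoeffU (negPf nvw) mulr0n if_same mulr0.
Qed.

Lemma mcoeffM_split p q (w : seq nat) :
  (p * q)@_(FMonom w) = \sum_(k < (size w).+1)
     p@_(FMonom (take k w)) * q@_(FMonom (drop k w)).
Proof.
have coefE (r : ncpoly K) v : r@_v = \sum_(m <- msupp r) r@_m *+ (m == v).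
  by rewrite {1}(monalgE r) raddf_sum; apply: eq_bigr => m _; rewrite /= mcoeffU.
rewrite mcoeffMl.
under [RHS]eq_bigr => k _.
  rewrite (coefE p) (coefE q) mulr_suml.
  under eq_bigr do rewrite mulr_sumr.
  over.
rewrite [RHS]exchange_big /=; apply: eq_bigr => m1 _.
rewrite exchange_big /=; apply: eq_bigr => m2 _.
under eq_bigr do rewrite mulrnAl mulrnAr -mulrnA mulnb.
rewrite sumrMnr; congr (_ *+ _).
case: m1 m2 => [u] [v]; rewrite -FMonomM.
have FE (x y : seq nat) : (FMonom x == FMonom y) = (x == y) by rewrite fmP.
under eq_bigr do rewrite !FE.
rewrite FE; have [<-|nuvw] := eqVneq (u ++ v) w.
  have ltu : (size u < (size (u ++ v)).+1)%N by rewrite size_cat ltnS leq_addr.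
  rewrite (bigD1 (Ordinal ltu)) //= take_size_cat // drop_size_cat // !eqxx.
  rewrite big1 // => k; apply: contraNeq; rewrite eqb0 negbK => /andP[_ /eqP uE].
  apply/eqP/val_inj; have := congr1 size uE.
  by rewrite size_takel /= => [->|]; rewrite // -ltnS.
rewrite big1 // => k _; apply/eqP; rewrite eqb0.
by apply: contraNN nuvw => /andP[/eqP-> /eqP->]; rewrite cat_take_drop.
Qed.

End NCPoly.

Section StableNCPoly.
Variable K : comNzRingType.

(* Sequences form an algebra under the componentwise operations. *)
Definition ncseq := nat -> ncpoly K.

HB.instance Definition _ := GRing.PzRing.on ncseq.
HB.instance Definition _ := GRing.Lmodule.on ncseq.

Fact ncseq_oner_neq0 : 1 != 0 :> ncseq.
Proof. by apply/eqP => /(congr1 (@^~ 0%N))/eqP; rewrite oner_eq0. Qed.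

HB.instance Definition _ :=
  GRing.PzSemiRing_isNonZero.Build ncseq ncseq_oner_neq0.

Fact ncseq_scaleAl (c : K) (P Q : ncseq) : c *: (P * Q) = (c *: P) * Q.
Proof. by apply/funext => n; exact: fgscaleAl. Qed.

HB.instance Definition _ :=
  GRing.Lmodule_isLalgebra.Build K ncseq ncseq_scaleAl.

Fact ncseq_scaleAr (c : K) (P Q : ncseq) : c *: (P * Q) = P * (c *: Q).
Proof. by apply/funext => n; exact: ncpoly_scaleAr. Qed.

HB.instance Definition _ := GRing.Lalgebra_isAlgebra.Build K ncseq ncseq_scaleAr.

Definition stable (P : ncseq) :=
  [/\ forall n, inNC n (P n),
      exists d, forall n, {in msupp (P n), forall w, (fdeg w <= d)%N}
    & forall n, subst (fun j => if j == n.+1 then 0 else ncvar K j) (P n.+1) = P n].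

Definition stable_pred : {pred ncseq} := fun P => `[< stable P >].

Fact stable_subalg_closed : subalg_closed stable_pred.
Proof.
have mem1 w : w \in msupp (1 : ncpoly K) -> w = FMonom [::].
  rewrite -mcoeff_neq0 mcoeff1; have [-> _|_] := eqVneq w mone.
    by apply/eqP; rewrite fmP fm1.
  by rewrite eqxx.
have suppZD (c : K) (p q : ncpoly K) w :
    w \in msupp (c *: p + q) -> w \in msupp p \/ w \in msupp q.
  move/(fsubsetP (msuppD_le _ _)); rewrite in_fsetU.
  by case/orP => [/(fsubsetP (msuppZ_le _ _))|]; [left|right].
split.
- apply/asboolP; split=> [n w /mem1 -> //| | n]; last by rewrite rmorph1.
  by exists 0%N => n w /mem1 ->.
- move=> c P Q /asboolP[PV [d Pd] PS] /asboolP[QV [e Qe] QS].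
  apply/asboolP; split=> [n w /suppZD[/PV|/QV] // | | n].
    exists (maxn d e) => n w /suppZD[/Pd|/Qe] h; rewrite leq_max h ?orbT //.
  by rewrite linearP /= PS QS.
- move=> P Q /asboolP[PV [d Pd] PS] /asboolP[QV [e Qe] QS].
  apply/asboolP; split=> [n w | | n].
  + case/msuppM_le => [w1 [w2 [/PV h1 /QV h2 ->]]].
    by rewrite /word_in fmM all_cat; apply/andP.
  + exists (d + e)%N => n w /msuppM_le[w1 [w2 [/Pd h1 /Qe h2 ->]]].
    by rewrite fdegM leq_add.
  + by rewrite rmorphM /= PS QS.
Qed.

HB.instance Definition _ :=
  GRing.isSubalgClosed.Build K ncseq stable_pred
    stable_subalg_closed.

Record stabNC := StabNC { stabNC_val :> nat -> ncpoly K;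
                          _ : stabNC_val \in stable_pred }.

HB.instance Definition _ : isSub ncseq stable_pred stabNC :=
  [isSub for stabNC_val].
HB.instance Definition _ := [Choice of stabNC by <:].
HB.instance Definition _ := [SubChoice_isSubAlgebra of stabNC by <:].

Lemma stabNCP (P : stabNC) : stable P.
Proof. by case: P => P /= /asboolP. Qed.

Lemma stabNC_coef (P : stabNC) m n (w : {fmonom nat}) :
  word_in m w -> (m <= n)%N -> (P n)@_w = (P m)@_w.
Proof.
have [_ _ PS] := stabNCP P.
move=> wm /subnKC <-; elim: (n - m)%N => [|k IHk]; first by rewrite addn0.
rewrite addnS -{}IHk -[in RHS]PS mcoeff_subst0; case: ifP => // mw.
by have := allP wm _ mw; rewrite /= ltnNge leq_addr.
Qed.

Section Pu.
Variable u : seq nat.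

(* The n-th component is the sum over words in the letters 1, ..., n; the
   ordinals 0, ..., n - 1 are shifted by one. *)
Definition Pu_seq : ncseq := fun n =>
  \sum_(w : (size u).-tuple 'I_n | pack [seq i.+1 | i : 'I_n <- w] == u)
     ncword K [seq i.+1 | i : 'I_n <- w].

Lemma word_inP n (w : seq nat) :
  reflect (exists t : seq 'I_n, w = [seq i.+1 | i : 'I_n <- t]) (word_in n w).
Proof.
apply: (iffP idP) => [|[t ->]]; last first.
  by apply/allP => _ /mapP[i _ ->] /=; apply: ltn_ord.
elim: w => [_|j w IHw /= /andP[/andP[j0 jn] /IHw[t ->]]]; first by exists [::].
have ltj : (j.-1 < n)%N by rewrite prednK.
by exists (Ordinal ltj :: t); rewrite /= prednK.
Qed.

Lemma mcoeff_Pu_seq n (w : {fmonom nat}) :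
  (Pu_seq n)@_w = (word_in n w && (pack w == u))%:R.
Proof.
rewrite /Pu_seq raddf_sum /=; case: w => w /=.
have FE (x y : seq nat) : (FMonom x == FMonom y) = (x == y) by rewrite fmP.
under eq_bigr do rewrite mcoeffU FE.
case: (word_inP n w) => [[t wE]|nw]; last first.
  by apply: big1 => t _; case: eqP => // tw; case: nw; exists t.
have linj : injective (fun t : seq 'I_n => [seq i.+1 | i : 'I_n <- t]).
  by apply: inj_map => i j [] /val_inj.
case: eqVneq => /= [wu|nwu]; last first.
  by apply: big1 => v /eqP vu; case: eqP => // vw; rewrite -vw vu eqxx in nwu.
have st : size t == size u by rewrite -wu size_pack wE size_map.
rewrite (bigD1 (Tuple st)) /= -?wE ?wu // eqxx big1 ?addr0 // => v /andP[_].
move=> nv; case: eqP => // vw; case/eqP: nv.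
by apply/val_inj; apply: linj; rewrite vw.
Qed.

Fact Pu_stable : Pu_seq \in stable_pred.
Proof.
apply/asboolP; split=> [n w | | n].
- by rewrite -mcoeff_neq0 mcoeff_Pu_seq; case: (word_in n w); rewrite // eqxx.
- exists (size u) => n w; rewrite -mcoeff_neq0 mcoeff_Pu_seq.
  case: andP => [[_ /eqP <-]|_]; first by rewrite size_pack.
  by rewrite eqxx.
- apply/malgP => w; rewrite mcoeff_subst0 !mcoeff_Pu_seq.
  case: ifPn => [nw|nw].
    case: (boolP (word_in n w)) => // /allP/(_ _ nw).
    by rewrite ltnn andbF.
  congr (_ && _)%:R; apply: eq_in_all => i iw /=; rewrite [(i <= n.+1)%N]leq_eqVlt ltnS.
  by case: eqP => // iE; rewrite -iE iw in nw.
Qed.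

Definition Pu : stabNC := StabNC Pu_stable.

End Pu.

(* The linear span of the P_u, for u packed. *)
Definition WQSym_pred : {pred stabNC} := fun F =>
  `[< exists (r : seq (seq nat)) (c : seq nat -> K),
        {in r, forall u, packed u} /\ F = \sum_(u <- r) c u *: Pu u >].

(* The left side puts a_i for a_{i+1} in P_n, and the right side is
   P_{n-2}(a_1, ..., a_{i-1}, a_{i+2}, ..., a_n). *)
Definition SolNC_pred : {pred stabNC} := fun P =>
  `[< forall n i, (2 <= n)%N -> (1 <= i < n)%N ->
        subst (fun j => ncvar K (if j == i.+1 then i else j)) (P n)
          = subst (fun j => ncvar K (if (j < i)%N then j else j.+2)) (P (n - 2)%N)
    >].

Fact SolNC_subalg_closed : subalg_closed SolNC_pred.
Proof.
split=> [|c P Q /asboolP hP /asboolP hQ|P Q /asboolP hP /asboolP hQ];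
  apply/asboolP => n i n2 iP.
- have E m s : subst s ((1 : stabNC) m) = 1 by exact: (rmorph1 (subst s)).
  exact: etrans (E _ _) (esym (E _ _)).
- have E m s : subst s ((c *: P + Q : stabNC) m)
                 = c *: subst s (P m) + subst s (Q m).
    exact: (linearP (subst s) c (P m) (Q m)).
  apply: etrans (E _ _) (etrans _ (esym (E _ _))).
  by rewrite (hP n i n2 iP) (hQ n i n2 iP).
- have E m s : subst s ((P * Q : stabNC) m) = subst s (P m) * subst s (Q m).
    exact: (rmorphM (subst s) (P m) (Q m)).
  apply: etrans (E _ _) (etrans _ (esym (E _ _))).
  by rewrite (hP n i n2 iP) (hQ n i n2 iP).
Qed.

HB.instance Definition _ :=
  GRing.isSubalgClosed.Build K stabNC SolNC_pred SolNC_subalg_closed.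

Record SolNC := MkSolNC { SolNC_val :> stabNC; _ : SolNC_val \in SolNC_pred }.

HB.instance Definition _ := [isSub for SolNC_val].
HB.instance Definition _ := [Choice of SolNC by <:].
HB.instance Definition _ := [SubChoice_isSubAlgebra of SolNC by <:].

Lemma mcoeff_span (r : seq (seq nat)) (c : seq nat -> K) n (w : {fmonom nat}) :
  ((\sum_(u <- r) c u *: Pu u : stabNC) n)@_w
    = if word_in n w then \sum_(u <- r) c u *+ (pack w == u) else 0.
Proof.
rewrite (big_morph (fun P : stabNC => (P n)@_w)
           (id1 := 0) (op1 := +%R)); first last.
- exact: mcoeff0.
- by move=> P Q; exact: mcoeffD.
case: ifP => wn; last first.
  by apply: big1 => u _; rewrite [LHS]mcoeffZ mcoeff_Pu_seq wn mulr0.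
by apply: eq_bigr => u _; rewrite [LHS]mcoeffZ mcoeff_Pu_seq wn mulr_natr.
Qed.

Lemma WQSymP (F : stabNC) :
  reflect (forall n (v w : {fmonom nat}), word_in n v -> word_in n w ->
             pack v = pack w -> (F n)@_v = (F n)@_w)
          (F \in WQSym_pred).
Proof.
apply: (iffP (asboolP _)) => [[r [c [_ ->]]] n v w vn wn vw|Fpack].
  by rewrite !mcoeff_span vn wn vw.
have [FV [d Fd] _] := stabNCP F.
pose r := undup (flatten [seq [seq pack [seq i.+1 | i : 'I_d <- t]
                              | t : k.-tuple 'I_d] | k <- iota 0 d.+1]).
have rP u : u \in r -> packed u.
  rewrite mem_undup => /flattenP[_ /mapP[k _ ->] /mapP[t _ ->]].
  exact: pack_packed.
exists r, (fun u => (F d)@_(FMonom u)); split=> [u /rP //|].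
apply/val_inj/funext => n; apply/malgP => w.
rewrite [RHS]mcoeff_span; case: ifPn => [wn|]; last first.
  by move=> wn; apply: mcoeff_outdom; apply: contra wn => /FV.
have [ltdw|lewd] := ltnP d (size w).
  rewrite big1_seq => [|u /andP[_]].
    by apply: mcoeff_outdom; apply/negP => /Fd; rewrite /fdeg leqNgt ltdw.
  rewrite mem_undup => /flattenP[_ /mapP[k kd ->] /mapP[t _ ->]].
  case: eqP => // /(congr1 size); rewrite !size_pack size_map size_tuple => wk.
  exfalso; move: kd; rewrite mem_iota add0n ltnS -wk => /andP[_].
  by rewrite leqNgt ltdw.
have pw m : (size w <= m)%N -> word_in m (pack w).
  move=> wm; apply: sub_all (pack_le_size w) => i /andP[-> iw] /=.
  exact: leq_trans iw wm.
have wr : pack w \in r.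
  have /word_inP[t tE] := pw d lewd.
  have st : size t == size w by rewrite -(size_pack w) tE size_map.
  rewrite mem_undup; apply/flattenP.
  exists [seq pack [seq i.+1 | i : 'I_d <- t] | t : (size w).-tuple 'I_d].
    by apply/mapP; exists (size w); rewrite // mem_iota ltnS.
  by apply/mapP; exists (Tuple st); rewrite ?mem_enum //= -tE packK.
rewrite (bigD1_seq (pack w)) ?undup_uniq //= eqxx big1 ?addr0 => [|u nuw]; last first.
  by rewrite eq_sym (negPf nuw).
have [nm dm] : (n <= maxn n d)%N /\ (d <= maxn n d)%N.
  by rewrite leq_maxl leq_maxr.
rewrite -(stabNC_coef F wn nm) -(stabNC_coef F (w := FMonom (pack w)) (pw d lewd) dm).
apply: Fpack; rewrite /= ?packK //; last exact: pw (leq_trans lewd dm).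
by apply: sub_all wn => i /andP[-> iw] /=; apply: leq_trans iw nm.
Qed.

Fact WQSym_subalg_closed : subalg_closed WQSym_pred.
Proof.
split=> [|c P Q /WQSymP hP /WQSymP hQ|P Q /WQSymP hP /WQSymP hQ];
  apply/WQSymP => n v w vn wn vw.
- have svw : size v = size w by rewrite -size_pack vw size_pack.
  by rewrite [LHS]mcoeff1 [RHS]mcoeff1 -!fdeg_eq0 /fdeg svw.
- rewrite [LHS]mcoeffD [RHS]mcoeffD [X in X + _]mcoeffZ.
  by rewrite [X in _ = X + _]mcoeffZ (hP n v w) // (hQ n v w).
- have svw : size v = size w by rewrite -size_pack vw size_pack.
  case: v w vn wn vw svw => v [w] /= vn wn vw svw.
  rewrite [LHS]mcoeffM_split [RHS]mcoeffM_split svw.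
  have sub_word (x y : seq nat) : {subset x <= y} -> word_in n y -> word_in n x.
    by move=> xy /allP yn; apply/allP => i /xy/yn.
  apply: eq_bigr => k _; congr (_ * _).
    apply: hP; rewrite /= -?(pack_take k v) -?(pack_take k w) ?vw //.
    + by apply: sub_word vn => i /mem_take.
    + by apply: sub_word wn => i /mem_take.
  apply: hQ; rewrite /= -?(pack_drop k v) -?(pack_drop k w) ?vw //.
  + by apply: sub_word vn => i /mem_drop.
  + by apply: sub_word wn => i /mem_drop.
Qed.

HB.instance Definition _ :=
  GRing.isSubalgClosed.Build K stabNC WQSym_pred WQSym_subalg_closed.

Record WQSym := MkWQSym { WQSym_val :> stabNC; _ : WQSym_val \in WQSym_pred }.

HB.instance Definition _ := [isSub for WQSym_val].
HB.instance Definition _ := [Choice of WQSym by <:].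
HB.instance Definition _ := [SubChoice_isSubAlgebra of WQSym by <:].

End StableNCPoly.

(* Main.v *)
(** The isomorphism Sol_NC -> WQSym keeps the odd variables: it maps P to
    P(a_1, 0, a_2, 0, a_3, ...), i.e. the coefficient of w in the image is that
    of 2w - 1 in P.  It is visibly a morphism, and its image consists of word
    quasi-symmetric functions because the coefficients of a solution do not
    change when all letters >= i are shifted by 2.  It is injective because the
    relation for a_i, a_{i+1} expresses a word with an even letter through words
    with fewer even letters.  It is surjective because F can be evaluated at
    the virtual alphabet a_1 - a_2 + a_3 - ...: writing a word as the sequence
    of the sets of positions of its letters, one replaces the blocks of even
    letters by the convolution inverse of the tautological block map; the
    relation for a_i, a_{i+1} then says that this is a two-sided inverse. *)

Require Import Defs.
From HB Require Import structures.
From mathcomp Require Import all_boot all_order all_algebra.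
From mathcomp Require Import reals complex.
From mathcomp Require Import finmap boolp zify.
From mathcomp.multinomials Require Import monalg.

Set Implicit Arguments.
Unset Strict Implicit.
Unset Printing Implicit Defensive.

Local Open Scope ring_scope.

(** * Convolution of functions on finite sets *)

Section SetConvolution.
Import GRing.Theory.
Variables (I : finType) (R : nzRingType).
Implicit Types (f g h : {set I} -> R) (S T U : {set I}).

(** [F S] looks at its argument only on proper subsets of [S], so iterating [F] from the zero
    function settles the value at [S] after [#|S|.+1] rounds. *)
Lemma set_recursion (F : {set I} -> ({set I} -> R) -> R) :
    (forall S f g, (forall T, T \proper S -> f T = g T) -> F S f = F S g) ->
  exists g, forall S, g S = F S g.
Proof.
move=> Fext; pose G n := iter n (fun f S => F S f) (fun=> 0).
have Gstep n m S : (#|S| < n)%N -> (#|S| < m)%N -> G n S = G m S.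
  elim: n m S => // n IHn [|m] S //= ltn ltm; apply: Fext => T /proper_card ltT.
  by apply: IHn; apply: leq_trans ltT _.
exists (fun S => G #|S|.+1 S) => S.
transitivity (F S (G #|S|)) => //; apply: Fext => T /proper_card ltT.
exact: (Gstep _ #|T|.+1).
Qed.

Lemma sum_subset_split S (G : {set I} -> R) :
  \sum_(T : {set I} | T \subset S) G T
    = G S + \sum_(T : {set I} | T \proper S) G T.
Proof.
rewrite (bigD1 S) //=; congr (_ + _); apply: eq_bigl => T.
by rewrite properEneq andbC.
Qed.

(* A left inverse and a right inverse for the convolution of set functions are
   both obtained by recursion; they agree by associativity. *)
Lemma convolution_inverse h : h set0 = 1 ->
  exists g, [/\ g set0 = 1,
    forall S, S != set0 -> \sum_(T : {set I} | T \subset S) h (S :\: T) * g T = 0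
  & forall S, S != set0 -> \sum_(T : {set I} | T \subset S) g (S :\: T) * h T = 0].
Proof.
move=> h0; pose d S : R := (S == set0)%:R.
have [r rE] : exists r, forall S, r S = d S -
    \sum_(T : {set I} | T \proper S) h (S :\: T) * r T.
  apply: (set_recursion (F := fun S r => d S - \sum_(T : {set I} | T \proper S)
    h (S :\: T) * r T)).
  by move=> S f g fg; congr (_ - _); apply: eq_bigr => T /fg ->.
have [l lE] : exists l, forall S, l S = d S -
    \sum_(T : {set I} | T \proper S) l T * h (S :\: T).
  apply: (set_recursion (F := fun S l => d S - \sum_(T : {set I} | T \proper S)
    l T * h (S :\: T))).
  by move=> S f g fg; congr (_ - _); apply: eq_bigr => T /fg ->.
have hr S : \sum_(T : {set I} | T \subset S) h (S :\: T) * r T = d S.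
  by rewrite sum_subset_split setDv h0 mul1r {1}rE subrK.
have lh S : \sum_(T : {set I} | T \subset S) l T * h (S :\: T) = d S.
  by rewrite sum_subset_split setDv h0 mulr1 {1}lE subrK.
have sub0 (G : {set I} -> R) : \sum_(T : {set I} | T \subset set0) G T = G set0.
  by rewrite (big_pred1 set0) // => T; rewrite subset0.
have dD S (G : {set I} -> R) :
    \sum_(T : {set I} | T \subset S) G T *+ (S :\: T == set0) = G S.
  rewrite (bigD1 S) //= setDv eqxx big1 ?addr0 // => T /andP[sT nT].
  rewrite (_ : (_ == _) = false) // setD_eq0.
  by apply: contraNF nT; rewrite eqEsubset sT.
have lr : l =1 r.
  move=> S; transitivity (\sum_(T : {set I} | T \subset S)
      \sum_(U : {set I} | U \subset S :\: T) l T * h (S :\: T :\: U) * r U).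
    rewrite -[LHS](dD S l); apply: eq_bigr => T sT.
    under eq_bigr do rewrite -mulrA.
    by rewrite -mulr_sumr hr mulr_natr.
  rewrite (exchange_big_dep (fun U => U \subset S)) /=; last first.
    by move=> T U _ sU; apply: subset_trans sU (subsetDl _ _).
  rewrite -[RHS](dD S r); apply: eq_bigr => U sU.
  rewrite -mulr_natl -[_%:R]/(d _) -lh mulr_suml.
  apply: eq_big => [T|T _]; last by rewrite setDDl setUC -setDDl.
  by rewrite !subsetD sU disjoint_sym; case: (T \subset S).
exists r; split=> [|S S0|S S0].
- by have := hr set0; rewrite sub0 setD0 h0 mul1r /d eqxx.
- by rewrite hr /d (negPf S0).
transitivity (d S); last by rewrite /d (negPf S0).
(* Complementation in [S] turns the identity [lh] for [l] into the claim for [r], since [l] and [r]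
   agree. *)
rewrite -lh [RHS](reindex_onto (fun T => S :\: T) (fun T => S :\: T)) /=; last first.
  by move=> T sT; rewrite setDDr setDv set0U (setIidPr sT).
apply: eq_big => [T|T sT].
  by rewrite subsetDl /= setDDr setDv set0U; apply/setIidPr/eqP.
by rewrite lr setDDr setDv set0U (setIidPr sT).
Qed.

End SetConvolution.

(** * Stable polynomials as functions on words *)

Section WordCoefficients.
Import GRing.Theory.

Variable K : comNzRingType.
Implicit Types (P Q : stabNC K) (p : ncpoly K) (w v : seq nat).

Lemma FMonom_eq w v : (FMonom w == FMonom v) = (w == v).
Proof. by rewrite fmP. Qed.

Lemma mcoeffE_msupp (T : choiceType) (p : {malg K[T]}) (x : T) :
  p@_x = \sum_(m <- msupp p) p@_m *+ (m == x).
Proof.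
by rewrite {1}(monalgE p) raddf_sum; apply: eq_bigr => m _; rewrite /= mcoeffU.
Qed.

(** The coefficient is read in the first component that has all letters of [w] as variables. By
    stability every later component gives the same value, so one function on words replaces the
    whole sequence. *)
Definition coef P w : K := (P (\max_(i <- w) i))@_(FMonom w).

Lemma mcoeff_coef P n w :
  (P n)@_(FMonom w) = if word_in n w then coef P w else 0.
Proof.
have [PV _ _] := stabNCP P.
have le_max : all (fun i => i <= \max_(j <- w) j)%N w.
  by apply/allP => i iw; rewrite (big_rem i iw) /= leq_maxl.
case: ifPn => [wn|nwn]; last by apply: mcoeff_outdom; apply: contra nwn => /PV.
apply: (@stabNC_coef K P _ _ (FMonom w)); rewrite /word_in /=.
  apply/allP => i iw; rewrite (allP le_max) // andbT.
  by have /andP[] := allP wn _ iw.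
elim: w wn {le_max} => [|i w IHw]; rewrite ?big_nil //= big_cons geq_max.
by case/andP => /andP[_ ->] /IHw.
Qed.

Lemma coef_inj P Q : coef P =1 coef Q -> P = Q.
Proof.
move=> eqPQ; apply/val_inj/funext => n; apply/malgP => -[w].
by rewrite /= !mcoeff_coef eqPQ.
Qed.

Lemma coef_eq0 P w : 0%N \in w -> coef P w = 0.
Proof.
move=> w0; rewrite /coef mcoeff_coef; case: ifP => // /allP/(_ _ w0).
by [].
Qed.

Lemma coef_degree P : exists d, forall w, (d < size w)%N -> coef P w = 0.
Proof.
have [_ [d Pd] _] := stabNCP P; exists d => w dw.
by apply: mcoeff_outdom; apply/negP => /Pd; rewrite /fdeg leqNgt dw.
Qed.

Lemma coef_sub P Q w : coef (P - Q) w = coef P w - coef Q w.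
Proof. exact: mcoeffB. Qed.

(** This builds stable polynomials from coefficients alone. Stability is automatic: all components
    take their coefficients from the same [c], and setting the last variable to 0 drops exactly the
    words that use it. *)
Lemma exists_coef (c : seq nat -> K) d :
    (forall w, (d < size w)%N -> c w = 0) -> (forall w, 0%N \in w -> c w = 0) ->
  exists P, coef P =1 c.
Proof.
move=> cd c0.
pose s n k (t : k.-tuple 'I_n) := [seq i.+1 | i : 'I_n <- t].
pose F : ncseq K := fun n =>
  \sum_(k < d.+1) \sum_(t : k.-tuple 'I_n) c (s n k t) *: ncword K (s n k t).
have FE n w : (F n)@_(FMonom w) = if word_in n w then c w else 0.
  have sinj : injective (fun t : seq 'I_n => [seq i.+1 | i : 'I_n <- t]).
    by apply: inj_map => i j [] /val_inj.
  rewrite /F raddf_sum /=.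
  under eq_bigr => k _.
    rewrite raddf_sum /=.
    under eq_bigr do rewrite mcoeffZ mcoeffU FMonom_eq mulr_natr.
    over.
  case: (word_inP n w) => [[t wE]|nw]; last first.
    rewrite big1 // => k _; rewrite big1 // => t _.
    by case: eqP => // tw; case: nw; exists t.
  have [ltdw|lewd] := ltnP d (size w).
    rewrite cd // big1 // => k _; rewrite big1 // => u _.
    case: eqP => // /(congr1 size); rewrite size_map size_tuple => kE.
    by move: ltdw; rewrite -kE ltnNge -ltnS ltn_ord.
  rewrite (bigD1 (Ordinal (lewd : size w < d.+1)%N)) //= [X in _ + X]big1 => [|k].
    have st : size t == size w by rewrite wE size_map.
    rewrite addr0 (bigD1 (Tuple st)) //= big1 => [|u].
      by rewrite addr0 /s /= -wE eqxx.
    move=> nu; case: eqP => // uw; case/eqP: nu.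
    by apply/val_inj/sinj; rewrite /= -wE.
  move=> nk; rewrite big1 // => u _; case: eqP => // /(congr1 size).
  rewrite size_map size_tuple => kE; case/eqP: nk.
  exact/val_inj.
have Fst : F \in @stable_pred K.
  apply/asboolP; split=> [n [w]|| n].
  - by rewrite -mcoeff_neq0 FE /=; case: ifP; rewrite // eqxx.
  - exists d => n [w]; rewrite -mcoeff_neq0 FE /fdeg /= leqNgt => nz.
    by apply: contraNN nz => /cd ->; rewrite if_same.
  - apply/malgP => -[w]; rewrite mcoeff_subst0 !FE /=.
    case: ifPn => [nw|nw].
      case: (boolP (word_in n w)) => // /allP/(_ _ nw).
      by rewrite ltnn andbF.
    congr (if _ then _ else _); apply: eq_in_all => i iw /=.
    rewrite [(i <= n.+1)%N]leq_eqVlt ltnS.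
    by case: eqP => // iE; rewrite -iE iw in nw.
exists (StabNC Fst) => w; have := mcoeff_coef (StabNC Fst) (\max_(i <- w) i) w.
rewrite [X in X = _]FE /=.
case: ifPn => // nw _; rewrite /coef /= FE (negPf nw).
case: (boolP (0%N \in w)) => [/c0 //|w0]; case/negP: nw.
apply/allP => i iw; rewrite lt0n (contraNneq _ w0) => [|<-] //=.
by rewrite (big_rem i iw) /= leq_maxl.
Qed.

(** * Renaming of variables, and the relation of Sol_NC read on coefficients *)

Lemma mcoeff_rename (g : nat -> nat) p v :
  (subst (fun j => ncvar K (g j)) p)@_(FMonom v)
    = \sum_(m <- msupp p) p@_m *+ (map g m == v).
Proof.
have prodE (m : {fmonom nat}) :
    prodw (fun j => ncvar K (g j)) m = << FMonom (map g m) >>.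
  by rewrite -prodw_ncvar /prodw /= big_map.
rewrite /subst mmapE raddf_sum; apply: eq_bigr => m _ /=.
by rewrite mul_malgC mcoeffZ prodE mcoeffU FMonom_eq mulr_natr.
Qed.

Lemma mcoeff_rename_inj (g : nat -> nat) p w : injective g ->
  (subst (fun j => ncvar K (g j)) p)@_(FMonom (map g w)) = p@_(FMonom w).
Proof.
move=> ginj; rewrite mcoeff_rename mcoeffE_msupp; apply: eq_bigr => -[m] _ /=.
by rewrite (inj_eq (inj_map ginj)) FMonom_eq.
Qed.

Lemma mcoeff_rename_out g p v j :
  j \in v -> (forall i, g i != j) ->
  (subst (fun j => ncvar K (g j)) p)@_(FMonom v) = 0.
Proof.
move=> jv gj; rewrite mcoeff_rename big1 // => m _; case: eqP => // vE.
by move: jv; rewrite -vE => /mapP[i _ jE]; move: (gj i); rewrite jE eqxx.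
Qed.

(** Words of length k are handled as functions on positions, so that the occurrences of a letter
    form a subset of ['I_k]. *)
Definition word_of k (w : 'I_k -> nat) : seq nat := map w (enum 'I_k).

Lemma size_word_of k (w : 'I_k -> nat) : size (word_of w) = k.
Proof. by rewrite size_map size_enum_ord. Qed.

Lemma word_of_nth v : word_of (fun q : 'I_(size v) => nth 0%N v q) = v.
Proof.
by rewrite /word_of (map_comp (nth 0%N v) val) val_enum_ord -/(mkseq _ _) mkseq_nth.
Qed.

Lemma eq_word_of k (w w' : 'I_k -> nat) : word_of w = word_of w' <-> w =1 w'.
Proof.
split=> [/eq_in_map ww' q|ww']; first by apply: ww'; rewrite mem_enum.
exact: eq_map.
Qed.

Lemma mem_word_of k (w : 'I_k -> nat) j :
  reflect (exists q, w q = j) (j \in word_of w).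
Proof.
apply: (iffP mapP) => [[q _ ->]|[q <-]]; exists q => //.
by rewrite mem_enum.
Qed.

Definition recolor k (w : 'I_k -> nat) (T : {set 'I_k}) j : 'I_k -> nat :=
  fun q => if q \in T then j else w q.

(** [merge i] and [skip2 i] are the renamings of indices on the two sides of the relation that
    defines Sol_NC. *)
Definition merge i j := if j == i.+1 then i else j.
Definition skip2 i j := if (j < i)%N then j else j.+2.

Lemma skip2_inj i : injective (skip2 i).
Proof.
by move=> a b; rewrite /skip2; case: (ltnP a i) => ha; case: (ltnP b i) => hb eqab; lia.
Qed.

(** A word that [merge i] sends to [w] arises from [w] by raising some of the occurrences of i to i
    + 1. The letter i + 1 itself is never produced by [merge i]. *)
Lemma mcoeff_merge i p k (w : 'I_k -> nat) :
  (subst (fun j => ncvar K (merge i j)) p)@_(FMonom (word_of w)) =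
  if i.+1 \in word_of w then 0 else
  \sum_(T : {set 'I_k} | T \subset [set q | w q == i])
    p@_(FMonom (word_of (recolor w T i.+1))).
Proof.
case: ifPn => [iw|niw].
  by apply: mcoeff_rename_out iw _ => j; rewrite /merge; case: (j =P i.+1); lia.
rewrite mcoeff_rename.
under [RHS]eq_bigr do rewrite mcoeffE_msupp.
rewrite exchange_big /=; apply: eq_bigr => -[m] _ /=.
rewrite sumrMnr; congr (_ *+ _).
under eq_bigr do rewrite FMonom_eq.
have [mw|nmw] := eqVneq (map (merge i) m) (word_of w); last first.
  rewrite big1 // => T /subsetP sT; case: eqP => // mE.
  case/eqP: nmw; rewrite mE -map_comp; apply: eq_map => q /=.
  rewrite /recolor /merge; case: (boolP (q \in T)) => [qT|_].
    by rewrite eqxx; have := sT _ qT; rewrite inE => /eqP.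
  case: eqP => // wq; case/negP: niw; apply/mem_word_of.
  by exists q.
have sm : size m = k by rewrite -(size_map (merge i)) mw size_word_of.
(* The positions of i + 1 in [m] form the only set of raised occurrences that gives [m] back. *)
subst k; pose T0 := [set q : 'I_(size m) | nth 0%N m q == i.+1].
have nthw q : w q = merge i (nth 0%N m q).
  rewrite -(nth_map 0%N 0%N) ?mw // (nth_map q) ?size_enum_ord //.
  by rewrite nth_ord_enum.
have mE (T : {set 'I_(size m)}) : T \subset [set q | w q == i] ->
    (m == word_of (recolor w T i.+1)) = (T == T0).
  move=> /subsetP sT; apply/eqP/eqP => [mT|->].
    apply/setP => q; have := congr1 (fun s => nth 0%N s q) mT.
    rewrite (nth_map q) ?size_enum_ord // nth_ord_enum /recolor inE => ->.
    case: (boolP (q \in T)) => _; rewrite ?eqxx //.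
    apply/esym/negP => /eqP wq; case/negP: niw; apply/mem_word_of.
    by exists q.
  rewrite -[LHS]word_of_nth; apply/eq_word_of => q.
  by rewrite /recolor inE nthw /merge; case: eqP.
rewrite (bigD1 T0) /=; last first.
  by apply/subsetP => q; rewrite !inE nthw /merge => ->.
rewrite mE ?eqxx; last first.
  by apply/subsetP => q; rewrite !inE nthw /merge => ->.
rewrite big1 // => T /andP[sT nT].
by rewrite mE // (negPf nT).
Qed.

Lemma word_in_max w n : 0%N \notin w -> (\max_(i <- w) i <= n)%N -> word_in n w.
Proof.
move=> w0 wn; apply/allP => i iw; rewrite lt0n (contraNneq _ w0) => [|<-] //=.
by apply: leq_trans wn; rewrite (big_rem i iw) /= leq_maxl.
Qed.

Lemma word_in_skip2 n i w : (0 < i < n)%N ->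
  word_in n (map (skip2 i) w) = word_in (n - 2) w.
Proof.
move=> /andP[i0 ltin]; rewrite /word_in all_map; apply: eq_all => j /=.
by rewrite /skip2; case: (ltnP j i) => ji; lia.
Qed.

Lemma word_in_recolor n i k (w : 'I_k -> nat) (T : {set 'I_k}) :
    (0 < i < n)%N -> T \subset [set q | w q == i] ->
  word_in n (word_of (recolor w T i.+1)) = word_in n (word_of w).
Proof.
move=> /andP[i0 ltin] /subsetP sT; rewrite /word_in !all_map.
apply: eq_all => q /=; rewrite /recolor; case: ifP => // /sT.
by rewrite inE => /eqP->; lia.
Qed.

(** These are the equations between coefficients in the relation of Sol_NC. Target words without i
    and i + 1 give the first clause, those with i but not i + 1 the second; those with i + 1 give 0
    = 0. *)
Definition cancelling (c : seq nat -> K) :=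
  (forall i w, (0 < i)%N -> c (map (skip2 i) w) = c w) /\
  (forall i k (w : 'I_k -> nat), (0 < i)%N ->
     i \in word_of w -> i.+1 \notin word_of w ->
     \sum_(T : {set 'I_k} | T \subset [set q | w q == i])
        c (word_of (recolor w T i.+1)) = 0).

Lemma merge_absent i p k (w : 'I_k -> nat) :
    i \notin word_of w -> i.+1 \notin word_of w ->
  (subst (fun j => ncvar K (merge i j)) p)@_(FMonom (word_of w))
    = p@_(FMonom (word_of w)).
Proof.
move=> iw i1w; rewrite mcoeff_merge (negPf i1w) (big_pred1 set0).
  by congr (_@_(FMonom _)); apply/eq_word_of => q; rewrite /recolor inE.
move=> T; rewrite /= -subset0 (_ : [set q | w q == i] = set0) //.
apply/setP => q; rewrite !inE; apply: contraNF iw => /eqP <-.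
by apply/mem_word_of; exists q.
Qed.

Lemma skip2_neq i j : (skip2 i j != i) && (skip2 i j != i.+1).
Proof. by rewrite /skip2; case: (ltnP j i) => ji; lia. Qed.

Lemma skip2_onto i j : j != i -> j != i.+1 -> exists j', skip2 i j' = j.
Proof.
move=> ji ji1; exists (if (j < i)%N then j else (j - 2)%N); rewrite /skip2.
by case: (ltnP j i) => jlt; [rewrite jlt | rewrite ifF; lia].
Qed.

Lemma SolNC_mcoeffP P :
  P \in @SolNC_pred K <-> forall n i v, (0 < i < n)%N ->
    (subst (fun j => ncvar K (merge i j)) (P n))@_(FMonom v)
    = (subst (fun j => ncvar K (skip2 i j)) (P (n - 2)%N))@_(FMonom v).
Proof.
split=> [/asboolP sol n i v iin|sol]; last first.
  by apply/asboolP => n i n2 iin; apply/malgP => -[v]; exact: sol.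
have n2 : (2 <= n)%N by lia.
have E : subst (fun j => ncvar K (merge i j)) (P n)
  = subst (fun j => ncvar K (skip2 i j)) (P (n - 2)%N) := sol n i n2 iin.
exact: (congr1 (fun p : ncpoly K => p@_(FMonom v)) E).
Qed.

Lemma cancelling_SolNC P : cancelling (coef P) -> P \in @SolNC_pred K.
Proof.
move=> [csh cca]; apply/SolNC_mcoeffP => n i v iin.
have i0 : (0 < i)%N by case/andP: iin.
rewrite -(word_of_nth v); move: (size v) (fun q => _) => k w {v}.
have [i1w|ni1w] := boolP (i.+1 \in word_of w).
  rewrite [LHS]mcoeff_merge i1w; apply/esym/(mcoeff_rename_out _ i1w) => j.
  by have /andP[] := skip2_neq i j.
(* If i occurs and i + 1 does not, the right side is 0 because [skip2 i] misses i, and the left side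
   is the sum of the second clause. In the remaining case the word lies in the image of
   [skip2 i]. *)
have [iw|niw] := boolP (i \in word_of w).
  have skip0 := mcoeff_rename_out (g := skip2 i) (P (n - 2)%N) iw.
  rewrite [LHS]mcoeff_merge (negPf ni1w) skip0 => [|j]; last first.
    by have /andP[] := skip2_neq i j.
  under eq_bigr => T sT do rewrite mcoeff_coef word_in_recolor //.
  by case: (word_in n _); [exact: cca | rewrite big1].
rewrite [LHS]merge_absent //.
have [u ->] : exists u, word_of w = map (skip2 i) u.
  elim: (word_of w) niw ni1w => [|j x IHx]; first by exists [::].
  rewrite !inE !negb_or 2![_ == j]eq_sym => /andP[ij ix] /andP[i1j i1x].
  have [u ->] := IHx ix i1x; have [j' <-] := skip2_onto ij i1j.
  by exists (j' :: u).
rewrite mcoeff_rename_inj; last exact: skip2_inj.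
by rewrite !mcoeff_coef word_in_skip2 // csh.
Qed.

Lemma SolNC_cancelling P : P \in @SolNC_pred K -> cancelling (coef P).
Proof.
move=> /SolNC_mcoeffP sol; split=> [i w i0|i k w i0 iw ni1w].
  have [w0|w0] := boolP (0%N \in w).
    rewrite !coef_eq0 //; apply/mapP; exists 0%N => //.
    by rewrite /skip2 i0.
  (* Large enough for [w] to be a word in n - 2 letters and for the relation at i to exist in
     component n. *)
  pose n := (\max_(j <- w) j + i + 2)%N.
  have iin : (0 < i < n)%N by rewrite i0 /n; lia.
  have wn : word_in (n - 2) w by apply: word_in_max => //; rewrite /n; lia.
  have := sol _ _ (map (skip2 i) w) iin.
  rewrite [X in _ = X -> _](mcoeff_rename_inj _ _ (@skip2_inj i)).
  rewrite [X in _ = X -> _]mcoeff_coef wn => <-.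
  set v := map _ _; rewrite -[in RHS](word_of_nth v) merge_absent; first last.
  - rewrite word_of_nth; apply/mapP => -[j _ iE].
    by have := skip2_neq i j; rewrite -iE eqxx andbF.
  - rewrite word_of_nth; apply/mapP => -[j _ iE].
    by have := skip2_neq i j; rewrite -iE eqxx.
  by rewrite word_of_nth mcoeff_coef word_in_skip2 // wn.
(* Recolouring changes only positions of the letter i > 0, so a letter 0 survives it and every term
   vanishes. *)
have [w0|w0] := boolP (0%N \in word_of w).
  rewrite big1 // => T /subsetP sT; rewrite coef_eq0 //.
  have /mem_word_of[q wq] := w0; apply/mem_word_of; exists q.
  rewrite /recolor; case: ifP => // /sT; rewrite inE wq => /eqP i00.
  by rewrite -i00 in i0.
pose n := (\max_(j <- word_of w) j + i + 2)%N.
have iin : (0 < i < n)%N by rewrite i0 /n; lia.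
have wn : word_in n (word_of w) by apply: word_in_max => //; rewrite /n; lia.
have := sol _ _ (word_of w) iin.
have skip0 := mcoeff_rename_out (g := skip2 i) (P (n - 2)%N) iw.
rewrite [X in X = _ -> _]mcoeff_merge (negPf ni1w) skip0 => [|j]; last first.
  by have /andP[] := skip2_neq i j.
by under eq_bigr => T sT do rewrite mcoeff_coef word_in_recolor // wn.
Qed.

(* Truncated subtraction makes this fix the letter 0. *)
Definition odds w := map (fun j => j.*2.-1) w.

Definition even_count k (w : 'I_k -> nat) := #|[set q | ~~ odd (w q)]|.

(* The relation for the letter m + 1 rewrites an occurrence set of the even
   letter m in terms of words with strictly fewer even letters. *)
Lemma cancelling_odds_eq0 (c : seq nat -> K) :
    cancelling c -> (forall w, 0%N \in w -> c w = 0) ->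
    (forall w, c (odds w) = 0) ->
  forall w, c w = 0.
Proof.
move=> [csh cca] c0 codd v; rewrite -(word_of_nth v).
move: (size v) (fun q => _) => k w {v}.
have [N] := ubnP (even_count w); elim: N w => // N IHN w ltN.
have [w0|w0] := boolP (0%N \in word_of w); first exact: c0.
have [/set0Pn[q0]|/negPn/eqP/setP even0] := boolP ([set q | ~~ odd (w q)] != set0);
  last first.
  rewrite (_ : word_of w = odds (word_of (uphalf \o w))) ?codd //.
  rewrite /odds -map_comp; apply: eq_map => q /=.
  by have := even0 q; rewrite !inE => /negbFE odd_w; lia.
rewrite inE => even_m; set m := w q0 in even_m.
have m0 : (0 < m)%N.
  by rewrite lt0n; apply: contraNneq w0 => <-; apply/mem_word_of; exists q0.
(* The shift turns m into m + 2 and frees m and m + 1. The word [w1] is the shifted word with m + 1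
   in place of m + 2; in its relation for m + 1 and m + 2, the term [T = U] is the shifted word. *)
rewrite -(csh m) //.
pose U := [set q | w q == m].
pose w1 q := if w q == m then m.+1 else skip2 m (w q).
have w1E q : (w1 q == m.+1) = (w q == m).
  by rewrite /w1 /skip2; case: (w q =P m); case: (ltnP (w q) m); lia.
have w1U : [set q | w1 q == m.+1] = U by apply/setP => q; rewrite !inE w1E.
have mw1 : m.+1 \in word_of w1.
  by apply/mem_word_of; exists q0; apply/eqP; rewrite w1E.
have mw1' : m.+2 \notin word_of w1.
  apply/mem_word_of => -[q]; rewrite /w1 /skip2.
  by case: (w q =P m); case: (ltnP (w q) m); lia.
have := cca m.+1 k w1 isT mw1 mw1'; rewrite w1U (bigD1 U) //= [X in _ + X]big1.
  rewrite addr0 => <-; congr c; rewrite /word_of -map_comp; apply: eq_map => q.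
  rewrite /recolor /w1 inE /=; case: eqP => // ->.
  by rewrite /skip2 ltnn.
(* For [T] other than [U], some position of [U] keeps the odd letter m + 1, while parities outside
   [U] are those of [w]. *)
move=> T /andP[sT nT]; apply: IHN; apply: leq_trans (ltN : (_ <= N)%N).
apply: proper_card; rewrite properE; apply/andP; split.
  apply/subsetP => q; rewrite !inE /recolor /w1 /skip2.
  have := subsetP sT q; rewrite inE; case: (q \in T) => [/(_ isT)/eqP->|_].
    by rewrite (negPf even_m).
  case: eqP => [->|_]; first by rewrite (negPf even_m).
  by case: ltnP => _; rewrite /= ?negbK.
have /properP[_ [q qU qT]] : T \proper U by rewrite properEneq nT.
apply/subsetPn; exists q; move: qU; rewrite !inE => wq.
  by rewrite (eqP wq).
by rewrite /recolor /w1 (negPf qT) wq /= negbK.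
Qed.

End WordCoefficients.

(** * Ordered products over the position sets of the letters of a word *)

Definition block k (w : 'I_k -> nat) j := [set q | w q == j].

Section BlockProducts.
Import GRing.Theory.
Variables (k : nat) (A : nzRingType) (V : zmodType) (ev : {additive A -> V}).
Variable X : nat -> {set 'I_k} -> A.
Hypothesis X0 : forall j, X j set0 = 1.
Hypothesis X2 : forall j, X j.+2 = X j.
Hypothesis X_cancel : forall j S, (0 < j)%N -> S != set0 ->
  \sum_(T : {set 'I_k} | T \subset S) X j (S :\: T) * X j.+1 T = 0.
Implicit Types (w : 'I_k -> nat) (S T : {set 'I_k}).

(** The factors stand in the order of the letters, as [A] may be noncommutative. By [X2] the map
    used for a letter depends only on its parity when the letter is positive. *)
Definition block_prod w a b := \prod_(a <= j < b) X j (block w j).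

Definition block_eval w := ev (block_prod w 1 (\max_q w q).+1).

Lemma block_prod_cat w b a c : (a <= b)%N -> (b <= c)%N ->
  block_prod w a c = block_prod w a b * block_prod w b c.
Proof. exact: big_cat_nat. Qed.

Lemma eq_block_prod w w' a b :
    (forall j, (a <= j < b)%N -> block w j = block w' j) ->
  block_prod w a b = block_prod w' a b.
Proof. by move=> ww'; apply: eq_big_nat => j /ww' ->. Qed.

Lemma block_prod_absent w a b :
  (forall j, (a <= j < b)%N -> block w j = set0) -> block_prod w a b = 1.
Proof.
move=> w0; rewrite /block_prod big_nat big1 // => j jab.
by rewrite w0 ?X0.
Qed.

Lemma block_prod_skip2 i w b :
  block_prod (skip2 i \o w) i.+2 b.+2 = block_prod w i b.
Proof.
rewrite /block_prod -addn2 big_addn subn2 /=; apply: eq_big_nat => j jP.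
rewrite addn2 X2; congr X.
by apply/setP => q; rewrite !inE /= /skip2; case: (ltnP (w q) i); lia.
Qed.

Lemma block_prod2 w a :
  block_prod w a a.+2 = X a (block w a) * X a.+1 (block w a.+1).
Proof. by rewrite /block_prod 2?big_ltn // big_geq // mulr1. Qed.

(** Letters above the largest one have empty blocks and contribute 1, so words with different
    largest letters can be compared over one range. *)
Lemma block_evalE w N : (forall q, w q <= N)%N ->
  block_eval w = ev (block_prod w 1 N.+1).
Proof.
move=> wN; rewrite /block_eval; set M := (\max_q w q)%N.
have leMN : (M <= N)%N by apply/bigmax_leqP.
rewrite (@block_prod_cat _ M.+1 1 N.+1) // [Y in _ * Y]block_prod_absent.
  by rewrite mulr1.
move=> j /andP[ltMj _]; apply/setP => q; rewrite !inE.
apply: contraTF ltMj => /eqP <-.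
by rewrite ltnNge negbK; apply: (leq_bigmax q).
Qed.

(** The factors below i are unchanged, those at i and i + 1 have empty blocks, and the later ones
    move by 2, which [X2] does not see. *)
Lemma block_eval_skip2 i w : (0 < i)%N ->
  block_eval (skip2 i \o w) = block_eval w.
Proof.
move=> i0; pose N := (i + \max_q w q)%N.
have wN q : (w q <= N)%N.
  by apply: leq_trans (leq_addl _ _); apply: (leq_bigmax q).
have leiN : (i <= N.+1)%N by rewrite /N; lia.
rewrite (block_evalE wN) (@block_evalE _ N.+2) => [|q]; last first.
  by have := wN q; rewrite /= /skip2; case: (ltnP (w q) i) => _; lia.
rewrite (@block_prod_cat w i) // (@block_prod_cat _ i 1 N.+3) //; last by lia.
rewrite (@block_prod_cat _ i.+2 i N.+3) ?block_prod_skip2 //; last by lia.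
rewrite (@block_prod_absent _ i) => [|j jP]; last first.
  apply/setP => q; rewrite !inE /= /skip2.
  by case: (ltnP (w q) i); lia.
rewrite mul1r (@eq_block_prod (skip2 i \o w) w) // => j jP.
by apply/setP => q; rewrite !inE /= /skip2; case: (ltnP (w q) i); lia.
Qed.

(** Recolouring affects only the two adjacent factors at i and i + 1. The rest is common to all
    terms, and the sum between them is the one in [X_cancel]. *)
Lemma block_eval_cancel i w : (0 < i)%N ->
    block w i != set0 -> block w i.+1 = set0 ->
  \sum_(T : {set 'I_k} | T \subset block w i) block_eval (recolor w T i.+1) = 0.
Proof.
move=> i0 wi wi1; pose N := (i.+1 + \max_q w q)%N.
have wN q : (w q <= N)%N.
  by apply: leq_trans (leq_addl _ _); apply: (leq_bigmax q).
pose C := block_prod w 1 i; pose B := block_prod w i.+2 N.+1.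
have splitE T : T \subset block w i ->
    block_eval (recolor w T i.+1) = ev
      (C * (X i (block w i :\: T) * X i.+1 T) * B).
  move=> /subsetP sT; rewrite (@block_evalE _ N) => [|q]; last first.
    by rewrite /recolor; case: ifP => // _; rewrite /N; lia.
  have [iN i1N] : (i <= N.+1)%N /\ (i.+2 <= N.+1)%N by rewrite /N; lia.
  rewrite (@block_prod_cat _ i) // (@block_prod_cat _ i.+2 i) ?(leqW (leqnSn i)) //.
  rewrite block_prod2.
  have blockE j : j != i -> j != i.+1 -> block (recolor w T i.+1) j = block w j.
    move=> ji ji1; apply/setP => q; rewrite !inE /recolor.
    case: ifP => // /sT; rewrite inE => /eqP->.
    by rewrite eq_sym (negPf ji1) eq_sym (negPf ji).
  rewrite (@eq_block_prod (recolor w T i.+1) w 1) => [|j jP]; last first.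
    by rewrite blockE //; lia.
  rewrite (@eq_block_prod (recolor w T i.+1) w i.+2) => [|j jP]; last first.
    by rewrite blockE //; lia.
  have -> : block (recolor w T i.+1) i = block w i :\: T.
    apply/setP => q; rewrite !inE /recolor; case: (boolP (q \in T)) => //= _.
    by apply/negbTE; rewrite neq_ltn ltnSn orbT.
  have -> : block (recolor w T i.+1) i.+1 = T.
    apply/setP => q; rewrite !inE /recolor.
    case: (boolP (q \in T)) => _; first by rewrite eqxx.
    by have /setP/(_ q) := wi1; rewrite !inE.
  by rewrite !mulrA.
rewrite (eq_bigr _ splitE) -raddf_sum -mulr_suml -mulr_sumr /=.
rewrite [Y in C * Y](_ : _ = 0); first by rewrite mulr0 mul0r raddf0.
exact: X_cancel.
Qed.

End BlockProducts.

(** * The alternating alphabet in the free algebra on position sets *)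

Section SignedBlocks.
Import GRing.Theory.
Variables (K : comNzRingType) (k : nat) (phi : seq {set 'I_k} -> K).
Local Notation blocks := {malg K[{fmonom {set 'I_k}}]}.
Implicit Types (w : 'I_k -> nat) (S T : {set 'I_k}).

(** This is the tautological block map. The empty set goes to 1 so that absent letters leave no
    trace in a product. *)
Definition atom S : blocks := if S == set0 then 1 else << FMonom [:: S] >>.

(** The linear extension of [phi] from lists of blocks; since [phi] is arbitrary, only additivity
    can be expected of it. *)
Definition blocks_eval (p : blocks) : K :=
  mmap idfun (fun m : {fmonom {set 'I_k}} => phi m) p.

Fact blocks_eval_is_zmod_morphism : zmod_morphism blocks_eval.
Proof. exact: mmap_is_additive. Qed.

HB.instance Definition _ :=
  GRing.isZmodMorphism.Build blocks K blocks_eval blocks_eval_is_zmod_morphism.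

Lemma blocks_evalU (m : {fmonom {set 'I_k}}) : blocks_eval << m >> = phi m.
Proof. by rewrite /blocks_eval mmapU /= mul1r. Qed.

Lemma blocks_eval_eq0 p : phi =1 (fun=> 0) -> blocks_eval p = 0.
Proof. by move=> phi0; rewrite /blocks_eval mmapE big1 // => m _; rewrite phi0 mulr0. Qed.

Variable anti : {set 'I_k} -> blocks.
Hypothesis anti0 : anti set0 = 1.
Hypothesis atom_anti : forall S, S != set0 ->
  \sum_(T : {set 'I_k} | T \subset S) atom (S :\: T) * anti T = 0.
Hypothesis anti_atom : forall S, S != set0 ->
  \sum_(T : {set 'I_k} | T \subset S) anti (S :\: T) * atom T = 0.
(** Even letters carry the convolution inverse of the map of odd letters, which realizes a_1 - a_2 +
    a_3 - ... on blocks. Neighbouring letters meet in either order of parity, hence the two-sided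
    inverse. *)
Definition signed_atom j := if odd j then atom else anti.

Lemma signed_atom0 j : signed_atom j set0 = 1.
Proof. by rewrite /signed_atom; case: odd; rewrite ?anti0 // /atom eqxx. Qed.

Lemma signed_atom_cancel j S : (0 < j)%N -> S != set0 ->
  \sum_(T : {set 'I_k} | T \subset S)
    signed_atom j (S :\: T) * signed_atom j.+1 T = 0.
Proof.
rewrite /signed_atom /= => _; case: (odd j) => /= S0.
  exact: atom_anti.
exact: anti_atom.
Qed.

Lemma signed_atom2 j : signed_atom j.+2 = signed_atom j.
Proof. by rewrite /signed_atom /= negbK. Qed.

Definition signed_eval : ('I_k -> nat) -> K :=
  block_eval blocks_eval signed_atom.

Lemma signed_eval_skip2 i w : (0 < i)%N ->
  signed_eval (skip2 i \o w) = signed_eval w.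
Proof. exact: (block_eval_skip2 _ signed_atom0 signed_atom2). Qed.

Lemma signed_eval_cancel i w : (0 < i)%N ->
    block w i != set0 -> block w i.+1 = set0 ->
  \sum_(T : {set 'I_k} | T \subset block w i) signed_eval (recolor w T i.+1) = 0.
Proof. exact: (block_eval_cancel _ signed_atom0 signed_atom_cancel). Qed.

(** All factors with nonempty blocks are atoms, so the product is the single monomial that lists
    these blocks by increasing letter. *)
Lemma signed_eval_odd w : (forall q, odd (w q)) ->
  signed_eval w = phi [seq block w j | j <- letters (word_of w)].
Proof.
move=> oddw; rewrite /signed_eval /block_eval; set M := (\max_q w q)%N.
have prodE (s : seq nat) : \prod_(j <- s) signed_atom j (block w j)
    = << FMonom [seq block w j | j <- s & block w j != set0] >>.
  elim: s => [|j s IHs].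
    by rewrite big_nil /GRing.one /= /fgone; congr mkmalgU; apply/eqP; rewrite fmP fm1.
  rewrite big_cons IHs /=; case: eqVneq => [->|nz] /=.
    by rewrite signed_atom0 mul1r.
  have -> : signed_atom j = atom.
    have /set0Pn[q] := nz; rewrite inE => /eqP <-.
    by rewrite /signed_atom oddw.
  rewrite /atom (negPf nz) malgM_def fgmulUU mulr1; congr mkmalgU.
  by apply/eqP; rewrite fmP fmM.
rewrite /block_prod prodE [LHS]blocks_evalU; congr (phi (map _ _)).
apply: (sorted_eq leq_trans anti_leq).
- by apply: sorted_filter; [exact: leq_trans | exact: iota_sorted].
- by apply: sort_sorted; exact: leq_total.
apply: uniq_perm; rewrite ?letters_uniq ?filter_uniq ?iota_uniq // => j.
rewrite mem_letters mem_filter mem_index_iota.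
apply/andP/mem_word_of => [[/set0Pn[q]]|[q <-]].
  by rewrite inE => /eqP jE _; exists q.
split; first by apply/set0Pn; exists q; rewrite inE.
rewrite ltnS (leq_bigmax q) andbT lt0n.
by apply: contraTneq (oddw q) => ->.
Qed.

End SignedBlocks.

(** * The specialization to odd variables and its image *)

Section OddSpecialization.
Import GRing.Theory.
Variable K : comNzRingType.
Implicit Types (P Q : stabNC K) (p : ncpoly K) (w v : seq nat).

Definition odd_var j : ncpoly K := if odd j then ncvar K (uphalf j) else 0.

(** The only word that the substitution turns into [v] is [odds v]. The letter 0 is treated apart
    because [odds] fixes it while [odd_var 0] is zero. *)
Lemma mcoeff_odd_var p v : 0%N \notin v ->
  (subst odd_var p)@_(FMonom v) = p@_(FMonom (odds v)).
Proof.
move=> v0; rewrite /subst mmapE raddf_sum [RHS]mcoeffE_msupp.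
apply: eq_bigr => -[m] _ /=.
have prodE : prodw odd_var (FMonom m)
    = if all odd m then << FMonom (map uphalf m) >> else 0.
  case: ifP => [/allP oddm|/negbT/allPn[j jm evenj]].
    rewrite -prodw_ncvar /prodw /= big_map; apply: eq_big_seq => j /oddm jodd.
    by rewrite /odd_var jodd.
  rewrite /prodw /=; case/splitPr: m / jm => m1 m2.
  by rewrite big_cat big_cons /= /odd_var (negPf evenj) mul0r mulr0.
rewrite mul_malgC mcoeffZ prodE (fun_if (mcoeff (FMonom v))) mcoeff0 mcoeffU.
rewrite !FMonom_eq.
have -> : (m == odds v) = all odd m && (map uphalf m == v).
  apply/eqP/andP => [->|[/allP oddm /eqP <-]].
    split.
      apply/allP => _ /mapP[j jv ->].
      have : j != 0%N by apply: contraNneq v0 => <-.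
      by case: j {jv} => //= j _; rewrite odd_double.
    rewrite -map_comp; apply/eqP; rewrite -[RHS]map_id; apply/eq_in_map => j jv /=.
    have : j != 0%N by apply: contraNneq v0 => <-.
    by lia.
  rewrite /odds -map_comp -[LHS]map_id; apply/eq_in_map => j /oddm jodd /=.
  by lia.
by case: (all odd m); rewrite ?mulr0 //= mulr_natr.
Qed.

Lemma mcoeff_odd_var0 p v : 0%N \in v -> (subst odd_var p)@_(FMonom v) = 0.
Proof.
move=> v0; rewrite /subst mmapE raddf_sum big1 // => -[m] _ /=.
rewrite mul_malgC mcoeffZ; have [oddm|/allPn[j jm evenj]] := boolP (all odd m).
  have -> : prodw odd_var (FMonom m) = << FMonom (map uphalf m) >>.
    rewrite -prodw_ncvar /prodw /= big_map; apply: eq_big_seq => j.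
    by move/(allP oddm) => jodd; rewrite /odd_var jodd.
  rewrite mcoeffU FMonom_eq; case: eqP => [vE|_]; last by rewrite mulr0.
  move: v0; rewrite -vE => /mapP[j /(allP oddm) jodd j0].
  by case: j jodd j0.
rewrite /prodw /=; case/splitPr: m / jm => m1 m2.
by rewrite big_cat big_cons /= /odd_var (negPf evenj) mul0r mulr0 mcoeff0 mulr0.
Qed.

Lemma mem0_odds w : (0%N \in w) = (0%N \in odds w).
Proof.
apply/idP/mapP => [w0|[[|j] jw] //=].
by exists 0%N.
Qed.

Lemma word_in_odds n w : word_in n.*2 (odds w) = word_in n w.
Proof. by rewrite /word_in all_map; apply: eq_all => j /=; lia. Qed.

(** Component 2n is taken because a word in the letters 1, ..., n has its odd version in letters up
    to 2n - 1. *)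
Definition odd_spec P : ncseq K := fun n => subst odd_var (P n.*2).

Lemma mcoeff_odd_spec P n w :
  (odd_spec P n)@_(FMonom w) = if word_in n w then coef P (odds w) else 0.
Proof.
have [w0|w0] := boolP (0%N \in w).
  by rewrite mcoeff_odd_var0 // coef_eq0 -?mem0_odds // if_same.
by rewrite mcoeff_odd_var // mcoeff_coef word_in_odds.
Qed.

(** The sequence is identified with the stable polynomial that [exists_coef] builds from the
    coefficients [coef P (odds w)]. The degree bound carries over because [odds] keeps lengths. *)
Lemma odd_spec_stable P : odd_spec P \in @stable_pred K.
Proof.
have [d Pd] := coef_degree P.
have [w|w|Q QE] := @exists_coef K (fun w => coef P (odds w)) d.
- by move=> dw; apply: Pd; rewrite size_map.
- by rewrite mem0_odds; apply: coef_eq0.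
suff -> : odd_spec P = Q by apply/asboolP/stabNCP.
apply/funext => n; apply/malgP => -[w].
by apply: etrans (mcoeff_odd_spec _ _ _) (esym _); rewrite mcoeff_coef QE.
Qed.

Definition odd_stabNC P : stabNC K := StabNC (odd_spec_stable P).

Lemma coef_odd_stabNC P w : coef (odd_stabNC P) w = coef P (odds w).
Proof.
have [w0|w0] := boolP (0%N \in w); first by rewrite !coef_eq0 // -mem0_odds.
by rewrite /coef mcoeff_odd_spec word_in_max.
Qed.

Lemma pack_gapless w N : word_in N w -> {subset iota 1 N <= w} -> pack w = w.
Proof.
move=> /allP wN Nw; have lettersE : letters w = iota 1 N.
  apply: (sorted_eq leq_trans anti_leq).
  - by apply: sort_sorted; exact: leq_total.
  - exact: iota_sorted.
  apply: uniq_perm; rewrite ?letters_uniq ?iota_uniq // => j.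
  rewrite mem_letters; apply/idP/idP => [/wN|/Nw //].
  by rewrite mem_iota add1n ltnS.
rewrite /pack lettersE -[RHS]map_id; apply/eq_in_map => j /wN /andP[j0 jN].
have -> : j = nth 0%N (iota 1 N) j.-1 by rewrite nth_iota; lia.
by rewrite index_uniq ?iota_uniq ?size_iota ?nth_iota; lia.
Qed.

(** Gaps are closed one at a time. If j is missing, lowering all letters above j by 1 keeps the
    packing, and on odd versions [skip2] at 2j - 1 undoes it. *)
Lemma coef_odds_pack (c : seq nat -> K) N w : cancelling c -> word_in N w ->
  c (odds (pack w)) = c (odds w).
Proof.
move=> [csh _]; elim: N w => [|N IHN] w wN.
  by rewrite (@pack_gapless w 0).
have [/allP full|/allPn[j]] := boolP (all (mem w) (iota 1 N.+1)).
  by rewrite (pack_gapless wN).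
rewrite mem_iota => /andP[j0 jN] jw.
pose lower x := if (x < j)%N then x else x.-1.
have wE x : x \in w -> (x != j) && (0 < x <= N.+1)%N.
  by move=> xw; rewrite (allP wN) // andbT; apply: contraNneq jw => <-.
have lower_mono : {in w &, {mono lower : x y / (x <= y)%N}}.
  move=> x y /wE xE /wE yE; rewrite /lower.
  by case: (ltnP x j); case: (ltnP y j); lia.
have lowerN : word_in N (map lower w).
  apply/allP => _ /mapP[x /wE xE ->]; rewrite /lower.
  by case: (ltnP x j); lia.
rewrite -(pack_map lower_mono) IHN //.
rewrite -(csh j.*2.-1); last by lia.
rewrite /odds -!map_comp; congr c; apply/eq_in_map => x /wE xE /=.
by rewrite /skip2 /lower; case: (ltnP x j) => xj; case: ltnP; lia.
Qed.

Lemma odd_stabNC_WQSym P : P \in @SolNC_pred K ->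
  odd_stabNC P \in @WQSym_pred K.
Proof.
move=> /SolNC_cancelling Pc; apply/WQSymP => n [v] [w] /= vn wn vw.
apply: etrans (mcoeff_odd_spec _ _ _) (etrans _ (esym (mcoeff_odd_spec _ _ _))).
rewrite vn wn -(coef_odds_pack Pc vn) -(coef_odds_pack Pc wn).
by rewrite (vw : pack v = pack w).
Qed.

(** * Lifting a word quasi-symmetric function to a solution *)

Lemma coef_WQSym F v w : F \in @WQSym_pred K -> 0%N \notin v -> 0%N \notin w ->
  pack v = pack w -> coef F v = coef F w.
Proof.
move=> /WQSymP Fpack v0 w0 vw.
pose n := maxn (\max_(i <- v) i) (\max_(i <- w) i).
have vn : word_in n v by apply: word_in_max; rewrite ?leq_maxl.
have wn : word_in n w by apply: word_in_max; rewrite ?leq_maxr.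
have := mcoeff_coef F n v; rewrite vn => <-.
have := mcoeff_coef F n w; rewrite wn => <-.
exact: Fpack n (FMonom v) (FMonom w) vn wn vw.
Qed.

(** This makes the coefficients of [F] a function on lists of blocks, which serves as [phi]. Lists
    that do not partition the positions get a value by default. *)
Definition rank_word k (m : seq {set 'I_k}) : seq nat :=
  [seq (find (fun S : {set 'I_k} => q \in S) m).+1 | q <- enum 'I_k].

Lemma rank_word_blocks k (w : 'I_k -> nat) :
  rank_word [seq block w j | j <- letters (word_of w)] = pack (word_of w).
Proof.
apply: etrans (map_comp _ w _); apply: eq_map => q /=; congr _.+1.
by rewrite find_map; apply: eq_find => j /=; rewrite inE eq_sym.
Qed.

Lemma signed_lift (F : stabNC K) : F \in @WQSym_pred K ->
  exists2 P, P \in @SolNC_pred K & odd_stabNC P = F.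
Proof.
move=> FW.
have atom0 k : atom K (set0 : {set 'I_k}) = 1 by rewrite /atom eqxx.
pose anti k := projT1 (cid (convolution_inverse (atom0 k))).
have antiP k := projT2 (cid (convolution_inverse (atom0 k))).
pose ev k (w : 'I_k -> nat) :=
  signed_eval (fun m => coef F (rank_word m)) (anti k) w.
(* The candidate coefficients evaluate [F] at the alternating alphabet; the letter 0 is excluded by
   hand, as [exists_coef] demands. *)
pose c v := if 0%N \in v then 0
  else ev (size v) (fun q : 'I_(size v) => nth 0%N v q).
have cE k (w : 'I_k -> nat) :
    c (word_of w) = if 0%N \in word_of w then 0 else ev k w.
  (* The length of [word_of w] equals k only up to a proof, so the word is generalized until k can
     be substituted. *)
  suff cv v : v = word_of w -> c v = if 0%N \in v then 0 else ev k w.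
    exact: cv.
  move=> vE; have sv : size v = k by rewrite vE size_word_of.
  subst k; rewrite /c; case: ifP => // _; congr (ev _ _).
  by apply/funext/eq_word_of; rewrite word_of_nth.
have [d Fd] := coef_degree F.
have [v dv|v v0|P PE] := @exists_coef K c d.
(* [rank_word] always returns a word of length k, so beyond the degree of [F] the whole function
   [phi] vanishes. *)
- rewrite /c; case: ifP => // _; apply: blocks_eval_eq0 => m.
  by rewrite Fd // size_map size_enum_ord.
- by rewrite /c v0.
have cc : cancelling c.
  split=> [i v i0|i k w i0 iw i1w].
    rewrite -(word_of_nth v); move: (size v) (fun q => _) => k w {v}.
    have -> : map (skip2 i) (word_of w) = word_of (skip2 i \o w).
      by rewrite /word_of -map_comp.
    rewrite !cE /ev signed_eval_skip2 //; last by have [] := antiP k.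
    congr (if _ then _ else _).
    apply/mem_word_of/mem_word_of => -[q]; rewrite /= /skip2 => wq; exists q.
      by move: wq; case: ltnP.
    by rewrite wq i0.
  have w0E (T : {set 'I_k}) : T \subset block w i ->
      (0%N \in word_of (recolor w T i.+1)) = (0%N \in word_of w).
    move=> /subsetP sT; apply/mem_word_of/mem_word_of => -[q].
      by rewrite /recolor; case: ifP => // _ wq; exists q.
    move=> wq; exists q; rewrite /recolor; case: ifP => // /sT.
    by rewrite inE wq => /eqP i00; rewrite -i00 in i0.
  under eq_bigr => T sT do rewrite cE w0E //.
  case: (0%N \in word_of w); first by rewrite big1.
  have [a0 ha ah] := antiP k; apply: (signed_eval_cancel _ a0 ha ah i0).
    apply/set0Pn; have /mem_word_of[q wq] := iw; exists q.
    by rewrite inE wq.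
  apply/setP => q; rewrite !inE; apply: contraNF i1w => /eqP <-.
  by apply/mem_word_of; exists q.
exists P; first by apply: cancelling_SolNC; rewrite (funext PE).
apply: coef_inj => v; rewrite coef_odd_stabNC PE.
have [v0|v0] := boolP (0%N \in v).
  by rewrite /c -mem0_odds v0 coef_eq0.
have nth0 (q : 'I_(size v)) : nth 0%N v q != 0%N.
  by apply: contraNneq v0 => <-; rewrite mem_nth.
have oddsE : odds v = word_of (fun q : 'I_(size v) => (nth 0%N v q).*2.-1).
  by rewrite -{1}(word_of_nth v) /odds /word_of -map_comp.
rewrite oddsE cE -oddsE -mem0_odds (negPf v0) /ev signed_eval_odd; first last.
- by move=> q; have := nth0 q; lia.
- by have [] := antiP (size v).
(* On odd words the evaluation gives the coefficient of [F] at the packing of [odds v], which is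
   also the packing of [v] because [odds] preserves the order of letters. *)
rewrite rank_word_blocks -oddsE; apply: coef_WQSym => //.
  by apply/negP => /mapP[].
rewrite packK; apply: pack_map => x y xv yv.
have : x != 0%N by apply: contraNneq v0 => <-.
by have : y != 0%N by [apply: contraNneq v0 => <-]; lia.
Qed.

(** * Injectivity and the isomorphism of algebras *)

Lemma odd_stabNC_inj P Q : P \in @SolNC_pred K -> Q \in @SolNC_pred K ->
  odd_stabNC P = odd_stabNC Q -> P = Q.
Proof.
move=> solP solQ eqPQ; apply/eqP; rewrite -subr_eq0; apply/eqP/coef_inj => w.
have PQsol : P - Q \in @SolNC_pred K by exact: (rpredB solP solQ).
have PQc := SolNC_cancelling PQsol.
rewrite (cancelling_odds_eq0 PQc) => [|u|u]; first last.
- by rewrite coef_sub -!coef_odd_stabNC eqPQ subrr.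
- exact: coef_eq0.
by rewrite /coef mcoeff0.
Qed.

Definition odd_map (P : SolNC K) : WQSym K :=
  MkWQSym (odd_stabNC_WQSym (valP P)).

Fact odd_map_is_zmod_morphism : zmod_morphism odd_map.
Proof.
move=> P Q; apply/val_inj/val_inj/funext => n.
exact: (raddfB (subst odd_var) (P n.*2) (Q n.*2)).
Qed.

Fact odd_map_is_scalable : scalable odd_map.
Proof.
move=> a P; apply/val_inj/val_inj/funext => n.
exact: (subst_is_scalable odd_var a (P n.*2)).
Qed.

Fact odd_map_is_monoid_morphism : monoid_morphism odd_map.
Proof.
split=> [|P Q]; apply/val_inj/val_inj/funext => n.
  exact: (rmorph1 (subst odd_var)).
exact: (rmorphM (subst odd_var) (P n.*2) (Q n.*2)).
Qed.

HB.instance Definition _ :=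
  GRing.isZmodMorphism.Build (SolNC K) (WQSym K) odd_map odd_map_is_zmod_morphism.
HB.instance Definition _ :=
  GRing.isScalable.Build K (SolNC K) (WQSym K) *:%R odd_map odd_map_is_scalable.
HB.instance Definition _ :=
  GRing.isMonoidMorphism.Build (SolNC K) (WQSym K) odd_map odd_map_is_monoid_morphism.

Lemma odd_map_bij : bijective odd_map.
Proof.
have odd_map_inj : injective odd_map.
  move=> x y /(congr1 val) eqxy; apply/val_inj.
  exact: (odd_stabNC_inj (valP x) (valP y) eqxy).
have odd_map_surj (F : WQSym K) : exists P : SolNC K, odd_map P = F.
  have [P solP PF] := signed_lift (valP F).
  by exists (MkSolNC solP); apply/val_inj.
exists (fun F => projT1 (cid (odd_map_surj F))) => [x|F]; last by case: cid.
by apply: odd_map_inj; case: cid.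
Qed.

End OddSpecialization.

Theorem theorem1p2 (R : realType) :
  exists f : {lrmorphism SolNC R[i] -> WQSym R[i]}, bijective f.
Proof.
exists (@odd_map R[i] : {lrmorphism SolNC R[i] -> WQSym R[i]}).
exact: odd_map_bij.
Qed.
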